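(* Let $\mathcal{M}=(\mathcal{T},\mathcal{E},\mathcal{P})$ be a mesh of $\Omega$ which is regular with parameters $\mu,\lambda\in(0,\frac12]$. Let $\alpha_\star>0$ be the constant, depending only on $\Omega$ and $\lambda$, of the discrete Trudinger inequality recalled in the context, and set $$\beta_\star=\frac{\alpha_\star^{d-1}d^d}{(d-1)^{d-1}},$$ which depends only on $\Omega$ and $\lambda$. Then for all $0<\beta<\beta_\star$ there is a constant $C_\beta$ depending only on $\Omega$, $\lambda$ and $\beta$ such that for any $u\in\mathbb{R}^{\mathcal{T}}$, $$\sum_{K\in\mathcal{T}}|K|\exp|u_K|\le C_\beta\exp\Big(\frac1\beta\|u\|_{1,d}^d\Big).$$
   Context: Domain. Let $d\ge 2$ be an integer and let $\Omega\subset\mathbb{R}^d$ be a bounded, connected, open polyhedral set, i.e. an open set whose closure equals the closure of a finite union of polyhedra, a polyhedron being a bounded intersection of finitely many half-spaces (possibly non-convex); $\Omega$ is moreover a Lipschitz domain. $|\cdot|$ denotes the Euclidean norm of vectors, and for sets the $d$- or $(d-1)$-dimensional Hausdorff measure, as appropriate. $B(a,r)$ is the open ball of center $a$ and radius $r$ in $\mathbb{R}^d$, and $B_{d'}$ is the unit open ball of $\mathbb{R}^{d'}$. Mesh. A mesh $\mathcal{M}=(\mathcal{T},\mathcal{E},\mathcal{P})$ of $\Omega$ consists of a set $\mathcal{T}$ of open connected polyhedral subsets of $\Omega$ (cells), a set $\mathcal{E}$ of non-empty relatively open connected polyhedral subsets of hyperplanes of $\mathbb{R}^d$ (faces), and a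 family $\mathcal{P}=(x_K)_{K\in\mathcal{T}}$ of points of $\Omega$ (cell centers), such that: (i) $\overline\Omega=\bigcup_{K\in\mathcal{T}}\overline K$; (ii) for each $K\in\mathcal{T}$ there is $\mathcal{E}_K\subset\mathcal{E}$ with $\partial K=\bigcup_{\sigma\in\mathcal{E}_K}\overline\sigma$ and $|\sigma\cap\sigma'|=0$ for distinct $\sigma,\sigma'\in\mathcal{E}_K$, and $\mathcal{E}=\bigcup_K\mathcal{E}_K$; (iii) for $K\ne L$ in $\mathcal{T}$, either $|\overline K\cap\partial L|=|\partial K\cap\overline L|=0$, or $\mathcal{E}_{KL}:=\mathcal{E}_K\cap\mathcal{E}_L$ is non-empty and $\overline K\cap\overline L=\bigcup_{\sigma\in\mathcal{E}_{KL}}\overline\sigma$; the set of interior faces is $\mathcal{E}_{\rm int}=\{\sigma\in\mathcal{E}:\exists K\neq L,\ \sigma\in\mathcal{E}_{KL}\}$; (iv) with $\mathcal{E}_{\rm ext}=\{\sigma\in\mathcal{E}:\sigma\subset\partial\Omega\}$, for each $K$ either $|\overline K\cap\partial\Omega|=0$ or $\overline K\cap\partial\Omega=\bigcup_{\sigma\in\mathcal{E}_K\cap\mathcal{E}_{\rm ext}}\overline\sigma$; (v) $x_K\in K$ for all $K$. For $\sigma\in\mathcal{E}_{\rm int}$ the pair $\{K,L\}$ with $\sigma\in\mathcal{E}_{KL}$ is unique. The mesh size is $h=\max_{K\in\mathcal{T}}\operatorname{diam}(K)$. Regularity. The mesh is regular with parameters $\mu,\lambda\in(0,\frac12]$ if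 every $K\in\mathcal{T}$ is star-shaped with respect to the ball $B(x_K,\mu h)$, and $\lambda^{d-1}h^{d-1}|B_{d-1}|\le|\sigma|$ for every $\sigma\in\mathcal{E}$. Dual mesh. $P_{K\sigma}$ is the open $d$-dimensional pyramid with base $\sigma\in\mathcal{E}_K$ and vertex $x_K$. For $\sigma\in\mathcal{E}_{\rm int}$, $\sigma\in\mathcal{E}_{KL}$, the diamond cell $D_\sigma$ is the interior of $\overline{P_{K\sigma}\cup P_{L\sigma}}$. Norms. For $u=(u_K)_{K\in\mathcal{T}}\in\mathbb{R}^{\mathcal{T}}$ let $u^{\mathcal{M}}=\sum_K u_K\mathbf{1}_K$, $\|u\|_{0,d}=\|u^{\mathcal{M}}\|_{L^d(\Omega)}$, $$|u|_{1,d}=\Big(\sum_{\sigma\in\mathcal{E}_{\rm int},\,\sigma\in\mathcal{E}_{KL}}|\sigma|^d|D_\sigma|^{1-d}|u_L-u_K|^d\Big)^{1/d},\qquad \|u\|_{1,d}=\|u\|_{0,d}+|u|_{1,d}.$$ The constant $\alpha_\star$. The discrete Trudinger inequality states that there is $\alpha_\star>0$ depending only on $\Omega$ and $\lambda$ such that for all $0\le\alpha<\alpha_\star$ there is $C_\alpha>0$ depending only on $\Omega,\lambda,\alpha$ with $\sum_{K\in\mathcal{T}}|K|\exp(\alpha|u_K|^{d/(d-1)})\le C_\alpha$ for every mesh of $\Omega$ regular with parameters $\mu,\lambda$ and every $u\in\mathbb{R}^{\mathcal{T}}$ with $\|u\|_{1,d}\le1$; $\alpha_\star$ is this constant. A constant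 depending only on listed data is independent of everything else, in particular of the mesh and of $u$. *)

(* Defs.v *)
From HB Require Import structures.
From mathcomp Require Import all_boot all_order all_algebra.
From mathcomp Require Import all_classical all_reals all_analysis.

Set Implicit Arguments.
Unset Strict Implicit.
Unset Printing Implicit Defensive.

Import Order.TTheory GRing.Theory Num.Theory.
Import numFieldNormedType.Exports.

Local Open Scope classical_set_scope.
Local Open Scope ring_scope.

Section euclidean.
Context {R : realType} {n : nat}.
Implicit Types (x y a : 'rV[R]_n) (A : set 'rV[R]_n).

Definition dotp x y : R := \sum_(i < n) x ord0 i * y ord0 i.

(* The norm `| x | of the library on 'rV[R]_n is the sup norm; it induces the
   same topology, which is the one used for closure, interior, open, ... *)
Definition enorm x : R := Num.sqrt (dotp x x).

Definition eball a (r : R) : set 'rV[R]_n := [set x | enorm (x - a) < r].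

Definition ebounded A := exists M : R, forall x, A x -> enorm x <= M.

(* Meaningful for bounded A only (a supremum in R); diam set0 = 0. *)
Definition diam A : R := sup [set enorm (x - y) | x in A & y in A].

Definition bdry A : set 'rV[R]_n := closure A `\` A°.

Definition segment x y : set 'rV[R]_n :=
  [set (1 - t) *: x + t *: y | t in [set t : R | 0 <= t <= 1]].

Definition star_shaped_wrt A (B : set 'rV[R]_n) :=
  forall x y, B x -> A y -> segment x y `<=` A.

End euclidean.

(* |B_n|, the volume of the Euclidean unit ball of R^n, by the recursion
   |B_(n+2)| = (2 pi / (n+2)) |B_n|. *)
Fixpoint unit_ball_volume {R : realType} (n : nat) : R :=
  match n with
  | 0%N => 1
  | 1%N => 2
  | m.+2 => 2 * pi / m.+2%:R * unit_ball_volume m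
  end.

(* k-dimensional Hausdorff measure in R^n, with the normalization for which it
   is the Lebesgue measure when k = n. *)
Section hausdorff.
Context {R : realType} {n : nat}.
Variable k : nat.
Implicit Types (A : set 'rV[R]_n) (delta : R).
Local Open Scope ereal_scope.

Definition hausdorff_gauge A : \bar R :=
  if A == set0 then 0
  else (unit_ball_volume k * (diam A / 2) ^+ k)%:E.

Definition delta_cover delta A : set (nat -> set 'rV[R]_n) :=
  [set F | (forall i x y, F i x -> F i y -> (enorm (x - y) <= delta)%R) /\
           A `<=` \bigcup_i F i].

Definition hausdorff_delta delta A : \bar R :=
  ereal_inf [set \sum_(i <oo) hausdorff_gauge (F i) | F in delta_cover delta A].

Definition hausdorff A : \bar R :=
  ereal_sup [set hausdorff_delta delta A | delta in [set delta | (0 < delta)%R]].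

Lemma unit_ball_volume_ge0 m : (0 <= unit_ball_volume m :> R)%R.
Proof.
suff [] : (0 <= unit_ball_volume m :> R)%R /\
  (0 <= unit_ball_volume m.+1 :> R)%R by [].
elim: m => [|m [h1 h2]]; first by split; rewrite /= ?ler01 ?ler0n.
split; first exact: h2.
apply: (mulr_ge0 _ h1); apply: divr_ge0; last exact: ler0n.
by apply: mulr_ge0; [exact: ler0n | exact: pi_ge0].
Qed.

Lemma diam_ge0 A : (0 <= diam A)%R.
Proof.
rewrite /diam; have [h|h] := pselect (has_sup [set enorm (x - y) | x in A & y in A]%classic).
  case: (h) => -[z Az] _.
  have zS := sup_upper_bound h; apply: (le_trans _ (zS _ Az)).
  by case: Az => x Ax [y Ay <-]; apply: sqrtr_ge0.
by rewrite sup_out.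
Qed.

Lemma hausdorff_gauge_ge0 A : 0 <= hausdorff_gauge A.
Proof.
rewrite /hausdorff_gauge; case: ifP => // _; rewrite lee_fin.
by rewrite mulr_ge0 ?unit_ball_volume_ge0// exprn_ge0// divr_ge0// diam_ge0.
Qed.

Lemma hausdorff_delta_ge0 delta A : 0 <= hausdorff_delta delta A.
Proof.
apply: le_ereal_inf_tmp => _ [F _ <-]; apply: nneseries_ge0 => i _ _.
exact: hausdorff_gauge_ge0.
Qed.

Lemma hausdorff_ge0 A : 0 <= hausdorff A.
Proof.
apply: le_trans (hausdorff_delta_ge0 1 A) _.
by apply: ereal_sup_ubound; exists 1%R => //=.
Qed.

Lemma hausdorff0 : hausdorff set0 = 0.
Proof.
apply/eqP; rewrite eq_le hausdorff_ge0 andbT.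
apply: ge_ereal_sup => _ [delta _ <-]; apply: ereal_inf_lbound.
exists (fun=> set0); first by split.
by apply: eseries0 => i _ _; rewrite /hausdorff_gauge eqxx.
Qed.

Lemma le_hausdorff : {homo hausdorff : A B / A `<=` B >-> A <= B}.
Proof.
move=> A B AB; apply: ge_ereal_sup => _ [delta delta0 <-].
apply: (@le_trans _ _ (hausdorff_delta delta B)).
  apply: ereal_inf_le_tmp => _ [F [dF BF] <-]; exists F => //.
  by split => //; exact: subset_trans BF.
by apply: ereal_sup_ubound; exists delta.
Qed.

Lemma hausdorff_delta_sigma_subadditive delta :
  sigma_subadditive (hausdorff_delta delta).
Proof.
move=> A; have [[i ioo]|] := pselect (exists i, hausdorff_delta delta (A i) = +oo).
  rewrite (eseries_pinfty _ _ ioo) ?leey// => m _.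
  by rewrite -ltNye (lt_le_trans _ (hausdorff_delta_ge0 _ _)).
rewrite -forallNE => Aoo.
suff add2e (e : {posnum R}) : hausdorff_delta delta (\bigcup_m A m) <=
    \sum_(i <oo) hausdorff_delta delta (A i) + e%:num%:E.
  by apply/lee_addgt0Pr => _/posnumP[].
rewrite (le_trans _ (epsilon_trick _ _ _))//; last first.
  by move=> m; exact: hausdorff_delta_ge0.
pose P m (B : (set 'rV[R]_n)^nat) := delta_cover delta (A m) B /\
  \sum_(l <oo) hausdorff_gauge (B l) <=
    hausdorff_delta delta (A m) + (e%:num / (2 ^ m.+1)%:R)%:E.
have [G PG] : {G : ((set 'rV[R]_n)^nat)^nat & forall m, P m (G m)}.
  apply: (@choice _ _ P) => m; rewrite /P /hausdorff_delta.
  set S := (X in ereal_inf X); move infS : (ereal_inf S) => iS.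
  case: iS infS => [r Sr|Soo|Soo].
  - have en1 : (0 < e%:num / (2 ^ m.+1)%:R)%R by [].
    have /(lb_ereal_inf_adherent en1) : ereal_inf S \is a fin_num by rewrite Sr.
    move=> [x [B dB muBx] xS].
    by exists B; split => //; rewrite muBx -Sr; exact/ltW.
  - by have := Aoo m; rewrite /hausdorff_delta Soo.
  - have := hausdorff_delta_ge0 delta (A m).
    by rewrite /hausdorff_delta -/S Soo.
have gG_ge0 x : 0 <= (hausdorff_gauge \o uncurry G) x.
  exact: hausdorff_gauge_ge0.
apply: (@le_trans _ _ (\esum_(i in setT) (hausdorff_gauge \o uncurry G) i)).
  apply: ereal_inf_lbound => /=.
  have /card_esym/ppcard_eqP[f] := card_nat2.
  exists (uncurry G \o f).
    split => [i x y|].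
      by rewrite /= /uncurry; case: (f i) => a b; exact: (PG a).1.1.
    move=> t [i _ Ait]; have [j _ Gt] := (PG i).1.2 _ Ait.
    by exists (f^-1%FUN (i, j)) => //=; rewrite invK ?inE.
  rewrite -(esum_pred_image (hausdorff_gauge \o uncurry G) _ xpredT)
    ?[fun=> _]set_true//.
  by rewrite image_eq.
rewrite (_ : esum _ _ =
    \sum_(i <oo) \sum_(j <oo ) hausdorff_gauge (G i j)); last first.
  pose J : nat -> set (nat * nat) := fun i => [set (i, j) | j in setT].
  rewrite (_ : setT = \bigcup_l J l); last first.
    by rewrite predeqE => -[a b]; split => // _; exists a => //; exists b.
  rewrite esum_bigcupT /=; last 2 first.
    - apply/trivIsetP => i j _ _ ij.
      rewrite predeqE => -[l m] /=; split => //= -[] [_] _ [<-{l} _].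
      by move=> [m' _] [] /esym/eqP; rewrite (negbTE ij).
    - by move=> /= [l m]; exact: hausdorff_gauge_ge0.
  rewrite -(image_id [set: nat]) -fun_true esum_pred_image//; last first.
    by move=> l _; apply: esum_ge0 => m _; exact: hausdorff_gauge_ge0.
  apply: eq_eseriesr => /= j _.
  rewrite -(esum_pred_image (hausdorff_gauge \o uncurry G) (pair j) predT)//=; last 2 first.
    - by move=> m _; exact: hausdorff_gauge_ge0.
    - by move=> ? ? _ _; exact: (@can_inj _ _ _ snd).
  by congr esum; rewrite predeqE => -[a b]; split; move=> [i _ <-]; exists i.
apply: lee_lim.
- apply: is_cvg_nneseries => l *.
  by apply: nneseries_ge0 => m *; exact: (gG_ge0 (l, m)).
- by apply: is_cvg_nneseries => l *; apply: adde_ge0 => //;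
    exact: hausdorff_delta_ge0.
- by near=> l; apply: lee_sum => i _; exact: (PG i).2.
Unshelve. all: by end_near. Qed.

Lemma hausdorff_sigma_subadditive : sigma_subadditive hausdorff.
Proof.
move=> A; apply: ge_ereal_sup => _ [delta delta0 <-].
apply: le_trans (hausdorff_delta_sigma_subadditive delta A) _.
apply: lee_nneseries => [i _ _|i _]; first exact: hausdorff_delta_ge0.
by apply: ereal_sup_ubound; exists delta.
Qed.

HB.instance Definition _ := isOuterMeasure.Build R 'rV[R]_n hausdorff
  hausdorff0 hausdorff_ge0 le_hausdorff hausdorff_sigma_subadditive.

End hausdorff.

(* Real-valued version, for sets of finite measure. *)
Definition hvol {R : realType} {n : nat} (k : nat) (A : set 'rV[R]_n) : R :=
  fine (hausdorff k A).

(* The Lebesgue measure of R^n is the restriction of the n-dimensional Hausdorff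
   measure to its Caratheodory-measurable sets. *)
Definition lebesgue_outer (R : realType) (n : nat) :
  {outer_measure set 'rV[R]_n -> \bar R} := @hausdorff R n n.

Definition lebesgue_measure_Rn (R : realType) (n : nat) :
    {measure set (caratheodory_type (lebesgue_outer R n)) -> \bar R} :=
  (lebesgue_outer R n : set (caratheodory_type (lebesgue_outer R n)) -> \bar R).

Definition Lpnorm {R : realType} {n : nat} (p : R) (Omega : set 'rV[R]_n)
    (f : 'rV[R]_n -> R) : R :=
  fine ('N[lebesgue_measure_Rn R n]_(p%:E) [(EFin \o f) \_ Omega])%E.

Section polyhedral.
Context {R : realType} {d : nat}.
Implicit Types A P s : set 'rV[R]_d.

(* Closed half-spaces are used: only closures of finite unions of polyhedra
   matter below, and flat polyhedra are needed for the faces. *)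
Definition polyhedron P := ebounded P /\
  exists hs : seq ('rV[R]_d * R), (forall h, h \in hs -> h.1 != 0) /\
    P = [set x | forall h, h \in hs -> dotp h.1 x <= h.2].

Definition polyhedral A := exists F : set (set 'rV[R]_d),
  [/\ finite_set F, forall P, F P -> polyhedron P &
      closure A = closure (\bigcup_(P in F) P)].

Definition hyperplane (a : 'rV[R]_d) (b : R) : set 'rV[R]_d :=
  [set x | dotp a x = b].

(* Near each boundary point, A is the strict epigraph, in some direction e, of
   a Lipschitz function of the component orthogonal to e. *)
Definition lipschitz_domain A := forall x, bdry A x ->
  exists (e : 'rV[R]_d) (r L : R) (g : 'rV[R]_d -> R),
    [/\ enorm e = 1, 0 < r,
        forall y z, `|g y - g z| <= L * enorm (y - z) &
        forall y, eball x r y ->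
          (A y <-> g (y - dotp y e *: e) < dotp y e)].

Definition admissible_domain A :=
  [/\ ebounded A, connected A, open A, polyhedral A & lipschitz_domain A].

Definition polyhedral_cell A := [/\ open A, connected A & polyhedral A].

Definition polyhedral_face s :=
  [/\ s !=set0, connected s, polyhedral s &
      exists (a : 'rV[R]_d) (b : R) (U : set 'rV[R]_d),
        [/\ a != 0, open U & s = U `&` hyperplane a b]].

End polyhedral.

Record mesh (R : realType) (d : nat) (Omega : set 'rV[R]_d) := Mesh {
  cells : set (set 'rV[R]_d);
  faces : set (set 'rV[R]_d);
  faces_of : set 'rV[R]_d -> set (set 'rV[R]_d);
  center : set 'rV[R]_d -> 'rV[R]_d;
  cells_finite : finite_set cells;
  faces_finite : finite_set faces;
  cells_polyhedral : forall K, cells K -> polyhedral_cell K /\ K `<=` Omega;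
  faces_polyhedral : forall s, faces s -> polyhedral_face s;
  mesh_cover : closure Omega = \bigcup_(K in cells) closure K;
  bdry_cell : forall K, cells K ->
    bdry K = \bigcup_(s in faces_of K) closure s;
  faces_of_null : forall K s s', cells K -> faces_of K s -> faces_of K s' ->
    s <> s' -> hausdorff d.-1 (s `&` s') = 0%E;
  facesE : faces = \bigcup_(K in cells) faces_of K;
  mesh_conform : forall K L, cells K -> cells L -> K <> L ->
    (hausdorff d.-1 (closure K `&` bdry L) = 0%E /\
     hausdorff d.-1 (bdry K `&` closure L) = 0%E) \/
    ((faces_of K `&` faces_of L) !=set0 /\
     closure K `&` closure L =
       \bigcup_(s in faces_of K `&` faces_of L) closure s);
  mesh_bdry : forall K, cells K ->
    hausdorff d.-1 (closure K `&` bdry Omega) = 0%E \/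
    closure K `&` bdry Omega =
      \bigcup_(s in faces_of K `&` [set s | faces s /\ s `<=` bdry Omega])
        closure s;
  center_in : forall K, cells K -> K (center K);
  (* an interior face separates only one pair of cells *)
  face_sides_unique : forall s K L K' L',
    cells K -> cells L -> K <> L -> faces_of K s -> faces_of L s ->
    cells K' -> cells L' -> K' <> L' -> faces_of K' s -> faces_of L' s ->
    [set K; L] = [set K'; L']
}.

Section mesh_theory.
Context {R : realType} {d : nat} {Omega : set 'rV[R]_d}.
Variable M : mesh Omega.
Implicit Types (K L s : set 'rV[R]_d).

(* s is in E_KL, K and L being distinct cells *)
Definition face_between s K L :=
  [/\ cells M K, cells M L, K <> L, faces_of M K s & faces_of M L s].

Definition interior_faces : set (set 'rV[R]_d) :=
  [set s | faces M s /\ exists K L, face_between s K L].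

Definition mesh_size : R := sup [set diam K | K in cells M].

Definition mesh_regular (mu lambda : R) :=
  [/\ 0 < mu <= 2^-1, 0 < lambda <= 2^-1,
      forall K, cells M K -> star_shaped_wrt K (eball (center M K) (mu * mesh_size)) &
      forall s, faces M s ->
        ((lambda ^+ d.-1 * mesh_size ^+ d.-1)%:E *
           hausdorff d.-1 (eball 0 1 : set 'rV[R]_d.-1) <= hausdorff d.-1 s)%E].

Definition pyramid K s : set 'rV[R]_d :=
  [set z | exists (t : R) (y : 'rV[R]_d),
     [/\ 0 < t < 1, s y & z = (1 - t) *: center M K + t *: y]].

(* The pair (K, L) of cells on both sides of an interior face, in an arbitrary
   order, on which nothing below depends. *)
Definition sides s : set 'rV[R]_d * set 'rV[R]_d :=
  xget (set0, set0) [set KL | face_between s KL.1 KL.2].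

Definition diamond s : set 'rV[R]_d :=
  (closure (pyramid (sides s).1 s `|` pyramid (sides s).2 s))°.

(* An element of R^cells is given by a function on all sets, of which only the
   values at cells are used. *)
Definition mesh_fun (u : set 'rV[R]_d -> R) (x : 'rV[R]_d) : R :=
  \sum_(K \in cells M) u K * \1_K x.

Definition norm0 (u : set 'rV[R]_d -> R) : R :=
  Lpnorm d%:R Omega (mesh_fun u).

Definition seminorm1 (u : set 'rV[R]_d -> R) : R :=
  (\sum_(s \in interior_faces)
     (hvol d.-1 s ^+ d * hvol d (diamond s) ^- d.-1 *
      `|u (sides s).2 - u (sides s).1| ^+ d)) `^ (d%:R^-1).

Definition norm1 (u : set 'rV[R]_d -> R) : R := norm0 u + seminorm1 u.

End mesh_theory.

(* alpha_star is a constant for which the discrete Trudinger inequality holds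
   on Omega, for meshes of regularity lambda. *)
Definition Trudinger_constant {R : realType} {d : nat} (Omega : set 'rV[R]_d)
    (lambda alpha_star : R) : Prop :=
  0 < alpha_star /\
  forall alpha, 0 <= alpha < alpha_star ->
  exists2 C : R, 0 < C &
  forall (mu : R) (M : mesh Omega), mesh_regular M mu lambda ->
  forall u : set 'rV[R]_d -> R, norm1 M u <= 1 ->
  \sum_(K \in cells M)
     (hvol d K * expR (alpha * `|u K| `^ (d%:R / d.-1%:R))) <= C.

(* Main.v *)
Require Import Defs.
From mathcomp Require Import all_boot all_order all_algebra.
From mathcomp Require Import all_classical all_reals all_analysis.
Import Order.TTheory GRing.Theory Num.Theory.
Import numFieldNormedType.Exports.
Local Open Scope classical_set_scope.
Local Open Scope ring_scope.

(** The exponential bound follows from the discrete Trudinger inequality by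
    scaling and Young's inequality. If [N > 0] bounds [norm1 M u], then
    [v = u / N] has norm at most [1]. The conjugate exponents [d] and
    [d / (d - 1)], with the weights of [young_conjugate_deg], give for each
    cell [K]
      [|u_K| = N |v_K| <= alpha |v_K|^(d / (d - 1)) + N^d / beta],
    where [beta = alpha^(d - 1) d^d / (d - 1)^(d - 1)]; this relation turns the
    condition [beta < beta_star] into [alpha < alpha_star]. Exponentiating and
    summing against [|K|], the Trudinger inequality for [v] bounds the sum by
    [C_alpha exp (N^d / beta)]. The choice [N = norm1 M u] concludes, unless
    that norm vanishes, where [N = 1] costs one more factor [exp (1 / beta)].

    The scaling step rests on the homogeneity of [norm1], whose [L^d] part is
    the delicate one: whether the cells are measurable for the Hausdorff measure
    is a separate question, so the integrand is treated as an arbitrary function.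
    The integral of a nonnegative function is a supremum over the simple
    functions below it, a description that commutes with positive factors for
    any such integrand ([ge0_integral_scale]). *)

Section integral_scaling.
Context d (T : measurableType d) (R : realType).
Variable mu : {measure set T -> \bar R}.
Local Open Scope ereal_scope.
Import HBNNSimple.

Lemma ge0_integral_scale_le (f : T -> \bar R) (k : R) : (0 < k)%R ->
  (forall x, 0 <= f x) ->
  k%:E * \int[mu]_x f x <= \int[mu]_x (k%:E * f x).
Proof.
move=> k0 f0; rewrite -lee_pdivlMl// ge0_integralTE//.
apply: ge_ereal_sup => _ [h /= hf <-]; rewrite lee_pdivlMl//.
rewrite ge0_integralTE; last by move=> x; rewrite mule_ge0// lee_fin ltW.
rewrite -sintegralrM; apply: ereal_sup_ubound.
exists (scale_nnsfun h (ltW k0)) => //= x.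
by rewrite EFinM lee_pmul2l// lte_fin.
Qed.

(** Multiplication by [k > 0] is a bijection from the simple functions below [f]
    onto those below [k f], so the identity holds for arbitrary nonnegative
    integrands, whereas [ge0_integralZl] concerns measurable ones. *)
Lemma ge0_integral_scale (f : T -> \bar R) (k : R) : (0 < k)%R ->
  (forall x, 0 <= f x) ->
  \int[mu]_x (k%:E * f x) = k%:E * \int[mu]_x f x.
Proof.
move=> k0 f0; apply/eqP; rewrite eq_le ge0_integral_scale_le// andbT.
(* the other inequality is the same one for the factor k^-1 *)
rewrite -lee_pdivrMl//.
have -> : \int[mu]_x f x = \int[mu]_x ((k^-1)%:E * (k%:E * f x)).
  by apply: eq_integral => x _; rewrite muleA -EFinM mulVf ?gt_eqF// mul1e.
apply: ge0_integral_scale_le; first by rewrite invr_gt0.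
by move=> x; rewrite mule_ge0// lee_fin ltW.
Qed.

Lemma Lnorm_scale (p k : R) (f : T -> \bar R) : (0 < p)%R -> (0 < k)%R ->
  'N[mu]_p%:E [(fun x => k%:E * f x)] = k%:E * 'N[mu]_p%:E [f].
Proof.
move=> p0 k0; rewrite unlock /=.
have -> : \int[mu]_x (`|k%:E * f x| `^ p) =
    \int[mu]_x ((k `^ p)%:E * (`|f x| `^ p)).
  apply: eq_integral => x _.
  by rewrite abseM gee0_abs ?poweRM ?lee_fin ?(ltW k0).
rewrite ge0_integral_scale ?powR_gt0//; last by move=> x; exact: poweR_ge0.
rewrite poweRM ?lee_fin ?powR_ge0//; last first.
  by apply: integral_ge0 => x _; exact: poweR_ge0.
by rewrite poweR_EFin -powRrM divff ?gt_eqF// powRr1// ltW.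
Qed.

End integral_scaling.

Lemma fine_scale (R : realType) (k : R) (x : \bar R) : 0 < k ->
  fine (k%:E * x)%E = k * fine x.
Proof.
move=> k0; case: x => [r| |] //=.
- by rewrite gt0_muley ?lte_fin// mulr0.
- by rewrite gt0_muleNy ?lte_fin// mulr0.
Qed.

Lemma hvol_ge0 (R : realType) (n k : nat) (A : set 'rV[R]_n) :
  0 <= hvol k A.
Proof. by apply: fine_ge0; exact: hausdorff_ge0. Qed.

Section norm_scaling.
Context {R : realType} {d : nat} {Omega : set 'rV[R]_d}.
Variable M : mesh Omega.
Implicit Types (u : set 'rV[R]_d -> R) (k : R).

Lemma mesh_fun_scale k u x :
  mesh_fun M (fun K => k * u K) x = k * mesh_fun M u x.
Proof.
rewrite /mesh_fun mulr_fsumr; apply: eq_fsbigr => K _.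
by rewrite mulrA.
Qed.

Lemma norm0_scale k u : (0 < d)%N -> 0 < k ->
  norm0 M (fun K => k * u K) = k * norm0 M u.
Proof.
move=> d0 k0; rewrite /norm0 /Lpnorm -fine_scale// -Lnorm_scale ?ltr0n//.
congr (fine (Lnorm _ _ _)); apply/funext => x.
rewrite /patch; case: ifP => _; last by rewrite mule0.
by rewrite /= mesh_fun_scale EFinM.
Qed.

Lemma seminorm1_scale k u : (0 < d)%N -> 0 < k ->
  seminorm1 M (fun K => k * u K) = k * seminorm1 M u.
Proof.
move=> d0 k0; rewrite /seminorm1.
under eq_fsbigr => s _.
  rewrite -mulrBr normrM (gtr0_norm k0) exprMn mulrCA; over.
rewrite -mulr_fsumr powRM ?exprn_ge0 ?(ltW k0)//; last first.
  apply: fsumr_ge0 => s _; rewrite !mulr_ge0 ?exprn_ge0//; last 2 first.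
    exact: hvol_ge0.
  by rewrite invr_ge0 exprn_ge0// hvol_ge0.
by rewrite -powR_mulrn ?(ltW k0)// -powRrM divff ?powRr1 ?(ltW k0)// pnatr_eq0 -lt0n.
Qed.

Lemma norm1_scale k u : (0 < d)%N -> 0 < k ->
  norm1 M (fun K => k * u K) = k * norm1 M u.
Proof. by move=> d0 k0; rewrite /norm1 norm0_scale// seminorm1_scale// mulrDr. Qed.

Lemma norm1_ge0 u : 0 <= norm1 M u.
Proof. by rewrite addr_ge0 ?powR_ge0// fine_ge0// Lnorm_ge0. Qed.

End norm_scaling.

(** Young's inequality for the factors [N / c] and [c * s], where [c] is chosen
    so that the coefficient of the second power is exactly [a]. *)
Lemma young_conjugate_deg (R : realType) (d : nat) (a N s : R) : (2 <= d)%N ->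
  0 < a -> 0 <= N -> 0 <= s ->
  N * s <= a * s `^ (d%:R / d.-1%:R) +
           (a ^+ d.-1 * d%:R ^+ d / d.-1%:R ^+ d.-1)^-1 * N ^+ d.
Proof.
case: d => [//|n] n1 a0 N0 s0 /=.
have nR0 : 0 < n%:R :> R by rewrite ltr0n.
have mR0 : 0 < n.+1%:R :> R by rewrite ltr0n.
set q : R := n.+1%:R / n%:R; have q0 : 0 < q by rewrite divr_gt0.
pose c : R := (a * q) `^ q^-1.
have c0 : 0 < c by rewrite powR_gt0// mulr_gt0.
have cq : c `^ q = a * q.
  by rewrite -powRrM mulVf ?gt_eqF// powRr1// ltW// mulr_gt0.
have cd : c ^+ n.+1 = (a * q) ^+ n.
  rewrite -powR_mulrn ?(ltW c0)// -powRrM -powR_mulrn ?(ltW (mulr_gt0 a0 q0))//.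
  by congr (_ `^ _); rewrite /q invf_div mulfVK// gt_eqF.
have conj : n.+1%:R^-1 + q^-1 = 1.
  by rewrite /q invf_div -[X in X + _]mul1r -mulrDl nat1r divff// gt_eqF.
have := @conjugate_powR R (N / c) (c * s) n.+1%:R q
  (divr_ge0 N0 (ltW c0)) (mulr_ge0 (ltW c0) s0) mR0 q0 conj.
rewrite mulrA mulfVK ?gt_eqF// powR_mulrn ?divr_ge0 ?(ltW c0)//.
rewrite powRM ?(ltW c0)// cq expr_div_n cd.
rewrite addrC; congr (_ <= _ + _).
  by rewrite mulrAC mulfK// gt_eqF.
rewrite -[LHS]mulrA [LHS]mulrC -invfM; congr (_^-1 * _).
by rewrite /q exprMn expr_div_n exprSr !mulrA [LHS]mulrAC.
Qed.

Theorem proposition4 (R : realType) (d : nat) (Omega : set 'rV[R]_d)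
    (lambda alpha_star : R) (d_ge2 : (2 <= d)%N)
    (hOmega : admissible_domain Omega)
    (hlambda : 0 < lambda <= 2^-1)
    (halpha : Trudinger_constant Omega lambda alpha_star) :
  let beta_star := alpha_star ^+ d.-1 * d%:R ^+ d / d.-1%:R ^+ d.-1 in
  forall beta : R, 0 < beta < beta_star ->
  exists C : R,
    forall (mu : R) (M : mesh Omega), mesh_regular M mu lambda ->
    forall u : set 'rV[R]_d -> R,
      \sum_(K \in cells M) (hvol d K * expR `|u K|) <=
        C * expR (beta^-1 * norm1 M u ^+ d).
Proof.
move=> beta_star beta /andP[beta0 beta_lt].
have d0 : (0 < d)%N by rewrite ltnW.
have d10 : (0 < d.-1)%N by rewrite -ltnS prednK.
have dR0 : 0 < d%:R :> R by rewrite ltr0n.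
have d1R0 : 0 < d.-1%:R :> R by rewrite ltr0n.
have [alpha_star0 trudinger] := halpha.
pose b : R := beta * d.-1%:R ^+ d.-1 / d%:R ^+ d.
have b0 : 0 < b by rewrite divr_gt0 ?mulr_gt0 ?exprn_gt0.
pose alpha : R := b `^ d.-1%:R^-1.
have alpha0 : 0 < alpha by rewrite powR_gt0.
have alphaX : alpha ^+ d.-1 = b.
  by rewrite -powR_mulrn ?(ltW alpha0)// -powRrM mulVf ?gt_eqF// powRr1// ltW.
have betaE : beta = alpha ^+ d.-1 * d%:R ^+ d / d.-1%:R ^+ d.-1.
  by rewrite alphaX /b mulfVK ?mulfK// gt_eqF ?exprn_gt0.
have alpha_lt : alpha < alpha_star.
  rewrite -(@ltr_pXn2r _ d.-1)// ?nnegrE ?ltW// alphaX /b.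
  rewrite ltr_pdivrMr ?exprn_gt0//.
  by rewrite -ltr_pdivlMr ?exprn_gt0.
have [|C C0 trudingerC] := trudinger alpha; first by rewrite (ltW alpha0).
(* C itself handles a positive norm1 M u; the factor expR beta^-1 pays for
   taking N = 1 when that norm is 0 *)
exists (C * expR beta^-1) => mu M Mreg u.
have scaled N : 0 < N -> norm1 M u <= N ->
    \sum_(K \in cells M) (hvol d K * expR `|u K|) <=
      C * expR (beta^-1 * N ^+ d).
  move=> N0 uN; pose v K := N^-1 * u K.
  have v1 : norm1 M v <= 1.
    by rewrite norm1_scale ?invr_gt0// mulrC ler_pdivrMr// mul1r.
  have := trudingerC mu M Mreg v v1.
  rewrite -(ler_pM2r (expR_gt0 (beta^-1 * N ^+ d))) mulr_fsuml.
  apply: le_trans; rewrite !fsbig_finite//; try exact: cells_finite.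
  apply: ler_sum => K _; rewrite -mulrA ler_wpM2l ?hvol_ge0//.
  rewrite -expRD ler_expR.
  have -> : `|u K| = N * `|v K|.
    by rewrite normrM gtr0_norm ?invr_gt0// mulVKf// gt_eqF.
  by rewrite [in leRHS]betaE; apply: young_conjugate_deg => //; exact: ltW.
have e1 : 1 <= expR beta^-1 :> R by rewrite -expR0 ler_expR invr_ge0 ltW.
have [u0|] := ltP 0 (norm1 M u).
  apply: le_trans (scaled _ u0 (lexx _)) _.
  by rewrite ler_pM2r ?expR_gt0// ler_peMr// ltW.
move=> uM0; have u0 : norm1 M u = 0 by apply/le_anti; rewrite uM0 norm1_ge0.
have := scaled 1; rewrite u0 expr0n gtn_eqF// mulr0 expR0 expr1n !mulr1.
by apply.
Qed.
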